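(* Let $G$ be a finite simple undirected graph. The following are equivalent: (a) $G$ is a split graph; (b) $G$ is chordal and $\overline{G}$ is chordal; (c) $G$ has a vertex ordering $(v_1,\dots,v_n)$ that simultaneously satisfies: for all $i<j<k$, if $v_iv_j\in E(G)$ and $v_iv_k\in E(G)$ then $v_jv_k\in E(G)$; and for all $i<j<k$, if $v_iv_j\in E(G)$ then $v_jv_k\in E(G)$ or $v_iv_k\in E(G)$; (d) $G$ has a vertex ordering $(v_1,\dots,v_n)$ such that for all $i<j<k$, if $v_iv_j\in E(G)$ then $v_jv_k\in E(G)$.
   Context: A vertex ordering of $G$ is a total order $(v_1,\dots,v_n)$ of $V(G)$. The complement $\overline{G}$ has vertex set $V(G)$ and edge set $\{vw: v\ne w,\ vw\notin E(G)\}$. A graph is chordal if every induced cycle on at least four vertices has a chord (equivalently, has no induced cycle of length at least four). $G$ is a split graph if $V(G)=K\cup I$ where $K$ induces a complete subgraph and $I$ is an independent set. *)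

(* Defs.v *)
From mathcomp Require Import all_boot.
Set Implicit Arguments.
Unset Strict Implicit.
Unset Printing Implicit Defensive.

(* A finite simple graph is a finType of vertices with a symmetric and
   irreflexive adjacency relation. *)

Section Graphs.

Variable T : finType.
Implicit Types (e : rel T) (c : seq T) (K I : {set T}).

Definition compl_graph e : rel T := [rel x y | (x != y) && ~~ e x y].

Definition clique e K : Prop := {in K &, forall x y, x != y -> e x y}.

Definition independent e I : Prop := {in I &, forall x y, ~~ e x y}.

Definition split_graph e : Prop :=
  exists K I, [/\ K :|: I = setT, clique e K & independent e I].

Definition consecutive c : rel T :=
  [rel x y | (y == next c x) || (x == next c y)].

(* c lists, without repetition and in cyclic order, the vertices of a cycle. *)
Definition graph_cycle e c : Prop := 3 <= size c /\ ucycle e c.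

Definition induced_cycle e c : Prop :=
  graph_cycle e c /\ {in c &, forall x y, e x y = consecutive c x y}.

Definition chordal e : Prop :=
  ~ exists c, 4 <= size c /\ induced_cycle e c.

(* v enumerates the vertex set; indices start at 0. *)
Definition vertex_ordering (v : 'I_#|T| -> T) : Prop := bijective v.

End Graphs.

(* Main.v *)
Require Import Defs.
From mathcomp Require Import all_boot.

(** The implication from (b) to (a) is the only substantial one. Chordality of
    [G] and of its complement excludes induced C4, C5 and 2K2. For an induced
    path [y x w u] this puts [N(u)] strictly inside [N(x)]: a neighbour [z] of
    [u] outside [N(x)] is adjacent to [y], as [x y] and [u z] do not form a
    2K2, and then [z y x w] is a C4 or [u z y x w] is a C5. Among the cliques
    of maximum size take [K] with the largest sum of degrees, and suppose that
    [x y] is an edge outside [K]. Excluding C4 and 2K2 makes the sets of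
    non-neighbours of [x] and [y] in [K] nested with at most one common
    element, so, say, [x] misses only [u] in [K] and [y] misses [u]. Replacing
    [u] by [x] in [K] gives another clique of maximum size, in which [y] must
    miss some [w]. Now [y x w u] is an induced path, so [x] has a larger degree
    than [u], against the choice of [K]. *)

Set Implicit Arguments.
Unset Strict Implicit.
Unset Printing Implicit Defensive.

Section Next.

Variables (T : finType) (c : seq T).
Hypothesis c_uniq : uniq c.

Lemma iter_next_eq x i j : x \in c -> i < size c -> j < size c ->
  (iter i (next c) x == iter j (next c) x) = (i == j).
Proof.
move=> xc ltic ltjc; have order_x := order_cycle (cycle_next c_uniq) c_uniq xc.
apply/eqP/eqP=> [eq_ij | -> //].
rewrite -(@findex_iter _ (next c) x i) ?order_x // eq_ij.
by rewrite findex_iter ?order_x.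
Qed.

Lemma next_nth_mod x0 i :
  i < size c -> next c (nth x0 c i) = nth x0 c (i.+1 %% size c).
Proof.
move=> ltic; rewrite next_nth mem_nth // index_uniq //.
case: c ltic => //= y s; rewrite ltnS leq_eqVlt => /predU1P[->|ltis].
  by rewrite modnn nth_default.
by rewrite modn_small //=; apply: set_nth_default.
Qed.

Lemma consecutive_nth x0 i j : i < j -> j < size c ->
  consecutive c (nth x0 c i) (nth x0 c j)
  = (j == i.+1) || (i == 0) && (j.+1 == size c).
Proof.
move=> ltij ltjc; have ltic := ltn_trans ltij ltjc.
have lt_mod k : k %% size c < size c by rewrite ltn_mod (leq_ltn_trans _ ltic).
rewrite /consecutive /= !next_nth_mod // !nth_uniq //.
rewrite modn_small; last exact: leq_ltn_trans ltij ltjc.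
move: ltjc; rewrite leq_eqVlt => /predU1P[->|lt_jSc].
  by rewrite modnn eqxx andbT.
rewrite modn_small // (ltn_eqF lt_jSc) (@ltn_eqF i j.+1) ?andbF //.
exact: ltnW.
Qed.

End Next.

Lemma sorted_vertex_ordering (T : finType) (r : rel T) :
  total r -> transitive r ->
  exists2 v : 'I_#|T| -> T,
    vertex_ordering v & {homo v : i j / i < j >-> r i j}.
Proof.
move=> r_total r_trans; pose s := sort r (enum T).
have size_s : size s == #|T| by rewrite size_sort cardE.
exists (tnth (Tuple size_s)).
  apply: inj_card_bij; last by rewrite card_ord.
  by apply/tuple_uniqP; rewrite /= sort_uniq enum_uniq.
move=> i j ltij; have x0 := tnth (Tuple size_s) i; rewrite !(tnth_nth x0) /=.
by apply: sorted_ltn_nth; rewrite ?inE ?(eqP size_s) //; apply: sort_sorted.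
Qed.

Section GraphClasses.

Variables (T : finType) (e : rel T).

Definition neighbours x : {set T} := [set y | e x y].

Definition maximum_clique (K : {set T}) : Prop :=
  clique e K /\ forall L, clique e L -> #|L| <= #|K|.

Definition heaviest_maximum_clique (w : T -> nat) (K : {set T}) : Prop :=
  maximum_clique K /\
  forall L, maximum_clique L -> \sum_(x in L) w x <= \sum_(x in K) w x.

Definition C4_free : Prop := forall a b c d : T,
  a != c -> b != d -> e a b -> e b c -> e c d -> e a d -> e a c || e b d.

Definition C5_free : Prop := forall a b c d f : T,
  e a b -> e b c -> e c d -> e d f -> e a f ->
  [|| e a c, e a d, e b d, e b f | e c f].

(* For symmetric [e] the vertices [a], [b], [c], [d] need not be assumed
   distinct: a coincidence makes one of the four adjacencies true. *)
Definition twoK2_free : Prop := forall a b c d : T,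
  e a b -> e c d -> [|| e a c, e a d, e b c | e b d].

Definition split_ordering (v : 'I_#|T| -> T) : Prop :=
  forall i j k : 'I_#|T|, i < j -> j < k -> e (v i) (v j) -> e (v j) (v k).

End GraphClasses.

Lemma adjacent_neq (T : finType) (e : rel T) x y :
  irreflexive e -> e x y -> x != y.
Proof. by move=> e_irr; apply: contraTneq => ->; rewrite e_irr. Qed.

Section ComplementGraph.

Variables (T : finType) (e : rel T).

Lemma compl_graph_sym : symmetric e -> symmetric (compl_graph e).
Proof. by move=> e_sym x y; rewrite /compl_graph /= eq_sym e_sym. Qed.

Lemma compl_graph_irr : irreflexive (compl_graph e).
Proof. by move=> x; rewrite /compl_graph /= eqxx. Qed.

Lemma split_graph_compl : split_graph e -> split_graph (compl_graph e).
Proof.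
move=> [K [I [KI K_clique I_indep]]]; exists I, K; split.
- by rewrite setUC.
- by move=> x y xI yI neq_xy; rewrite /compl_graph /= neq_xy I_indep.
- move=> x y xK yK; rewrite /compl_graph /=; case: eqVneq => //= neq_xy.
  by rewrite K_clique.
Qed.

Lemma compl_C4_free_twoK2_free :
  symmetric e -> irreflexive e -> C4_free (compl_graph e) -> twoK2_free e.
Proof.
move=> e_sym e_irr compl_C4_free a b c d ab cd; apply: contraT.
rewrite !negb_or => /and4P[ac ad bc bd].
have neq x y z : e x z -> ~~ e y z -> x != y.
  by move=> xz; apply: contraNneq => <-.
have := compl_C4_free a c b d (adjacent_neq e_irr ab) (adjacent_neq e_irr cd).
rewrite /compl_graph /= ab cd !andbF; apply.
- by rewrite ac eq_sym (neq c a d).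
- by rewrite e_sym bc (neq c b d).
- by rewrite bd eq_sym (neq d b c) // e_sym.
- by rewrite ad eq_sym (neq d a c) // e_sym.
Qed.

End ComplementGraph.

Section SplitGraphs.

Variables (T : finType) (e : rel T).

Lemma split_graphP :
  split_graph e <-> exists2 K, clique e K & independent e (~: K).
Proof.
split=> [[K [I [KI K_clique I_indep]]] | [K K_clique K_indep]]; last first.
  by exists K, (~: K); split; first exact: setUCr.
have subI x : x \in ~: K -> x \in I.
  by have := in_setT x; rewrite -KI !inE => /orP[->|].
by exists K => // x y /subI xI /subI yI; apply: I_indep.
Qed.

Lemma induced_cycle_next2 c x : 4 <= size c -> induced_cycle e c -> x \in c ->
  (next c (next c x) != x) && ~~ e x (next c (next c x)).
Proof.
move=> size_c [[_ /andP[_ c_uniq]] c_ind] xc.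
have iter_eq i j : i < 4 -> j < 4 ->
    (iter i (next c) x == iter j (next c) x) = (i == j).
  by move=> lti ltj; rewrite iter_next_eq // (leq_trans _ size_c).
rewrite (iter_eq 2 0) // c_ind ?mem_next // negb_or /=.
by rewrite (iter_eq 2 1) ?(iter_eq 0 3).
Qed.

Lemma split_graph_chordal : split_graph e -> chordal e.
Proof.
move=> /split_graphP[K K_clique K_indep] [c [size_c c_ind]].
have [[_ /andP[c_cycle _]] _] := c_ind.
have next_in x : x \in c -> x \notin K -> next c x \in K.
  move=> xc xK; apply: contraLR (next_cycle c_cycle xc) => nextK.
  by apply: K_indep; rewrite inE.
have next2_notin x : x \in c -> x \in K -> next c (next c x) \notin K.
  move=> xc xK; have /andP[] := induced_cycle_next2 size_c c_ind xc.
  by rewrite eq_sym => neq_x; apply: contra => /(K_clique _ _ xK)->.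
have [y yc yK] : exists2 y, y \in c & y \in K.
  have [x xc] : exists x, x \in c.
    by case: (c) size_c => // x s _; exists x; apply: mem_head.
  have [xK | xK] := boolP (x \in K); first by exists x.
  by exists (next c x); rewrite ?mem_next ?next_in.
have y2K := next2_notin y yc yK.
have y1K : next c y \in K.
  by apply: contraNT y2K; apply: next_in; rewrite mem_next.
have /negP[] : next c (next c (next c y)) \notin K.
  by apply: next2_notin; rewrite ?mem_next.
by apply: next_in; rewrite ?mem_next.
Qed.

Lemma split_graph_ordering :
  split_graph e -> exists2 v, vertex_ordering v & split_ordering e v.
Proof.
move=> /split_graphP[K K_clique K_indep].
have [|v v_bij K_last] := @sorted_vertex_ordering T
  (relpre (fun x => x \in K : nat) leq) (fun x y => leq_total _ _).
  by move=> y x z; apply: leq_trans.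
have K_up (i j : 'I_#|T|) : i < j -> v i \in K -> v j \in K.
  by move=> /K_last /=; case: (v i \in K); case: (v j \in K).
exists v => // i j k ltij ltjk eij.
have jK : v j \in K.
  apply: contraLR eij => jK; apply: K_indep; rewrite inE //.
  by apply: contra jK; apply: K_up.
by apply: K_clique (K_up j k ltjk jK) _; rewrite // (bij_eq v_bij) neq_ltn ltjk.
Qed.

Lemma split_ordering_split_graph v :
  symmetric e -> irreflexive e ->
  vertex_ordering v -> split_ordering e v -> split_graph e.
Proof.
move=> e_sym e_irr [w vK wK] v_split.
pose K := [set x | [exists i : 'I_#|T|, (i < w x) && e (v i) x]].
have edge_to_later x y : x \in K -> w x < w y -> e x y.
  rewrite inE => /existsP[i /andP[ltix eix]] ltxy.
  by rewrite -(wK x) -(wK y); apply: (v_split i) => //; rewrite wK.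
have no_edge_from_earlier x y : y \in ~: K -> w x < w y -> ~~ e x y.
  rewrite !inE negb_exists => /forallP/(_ (w x)) + ltxy.
  by rewrite ltxy wK.
apply/split_graphP; exists K => x y xK yK; first move=> neq_xy.
  have : w x != w y by rewrite (can_eq wK).
  by rewrite neq_ltn => /orP[] lt; [|rewrite e_sym]; apply: edge_to_later.
case: (ltngtP (w x) (w y)) => [lt|lt|/val_inj/(can_inj wK)->].
- exact: no_edge_from_earlier.
- by rewrite e_sym no_edge_from_earlier.
- by rewrite e_irr.
Qed.

End SplitGraphs.

Section Holes.

Variables (T : finType) (e : rel T).
Hypotheses (e_sym : symmetric e) (e_irr : irreflexive e).

Lemma chordal_no_hole x0 c : chordal e -> uniq c -> 4 <= size c ->
  ~ forall i j, i < j -> j < size c ->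
      e (nth x0 c i) (nth x0 c j) = (j == i.+1) || (i == 0) && (j.+1 == size c).
Proof.
move=> e_chordal c_uniq size_c hole; case: e_chordal; exists c; split=> //.
have c_ind : {in c &, forall x y, e x y = consecutive c x y}.
  move=> _ _ /(nthP x0)[i ltic <-] /(nthP x0)[j ltjc <-].
  case: (ltngtP i j) => [ltij | ltji | <-].
  - by rewrite hole ?consecutive_nth ?ltij.
  - rewrite e_sym hole // -(consecutive_nth c_uniq x0) //.
    by rewrite /consecutive /= orbC.
  - rewrite e_irr /consecutive /= orbb.
    rewrite (iter_next_eq c_uniq (i := 0) (j := 1)) ?mem_nth //;
      exact: leq_trans size_c.
split=> //; split; first exact: ltnW.
rewrite /ucycle c_uniq andbT; apply: cycle_from_next => // x xc.
by rewrite c_ind ?mem_next // /consecutive /= eqxx.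
Qed.

Lemma chordal_C4_free : chordal e -> C4_free e.
Proof.
move=> e_chordal a b c d neq_ac neq_bd ab bc cd ad; apply: contraT.
rewrite negb_or => /andP[/negPf ac /negPf bd].
have c_uniq : uniq [:: a; b; c; d].
  by rewrite /= !inE !negb_or neq_ac neq_bd !(adjacent_neq e_irr).
case: (@chordal_no_hole a _ e_chordal c_uniq isT).
by move=> [|[|[|[|i]]]] [|[|[|[|j]]]].
Qed.

Lemma chordal_C5_free : chordal e -> C5_free e.
Proof.
move=> e_chordal a b c d f ab bc cd df af; apply: contraT.
rewrite !negb_or => /and5P[/negPf ac /negPf ad /negPf bd /negPf bf /negPf cf].
have sym x y t : e x y = t -> e y x = t by rewrite e_sym.
have neq x y z : e x z = true -> e y z = false -> x != y.
  by move=> xz; apply: contraFneq => <-.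
have c_uniq : uniq [:: a; b; c; d; f].
  rewrite /= !inE !negb_or (neq _ _ _ af cf).
  rewrite (neq _ _ _ ab (sym _ _ _ bd)) (neq _ _ _ bc (sym _ _ _ cf)).
  rewrite (neq _ _ _ (sym _ _ _ ab) (sym _ _ _ ad)).
  by rewrite (neq _ _ _ (sym _ _ _ bc) (sym _ _ _ bf)) !(adjacent_neq e_irr).
case: (@chordal_no_hole a _ e_chordal c_uniq isT).
by move=> [|[|[|[|[|i]]]]] [|[|[|[|[|j]]]]].
Qed.

End Holes.

Section MaximumCliques.

Variables (T : finType) (e : rel T).
Implicit Types K L : {set T}.

Lemma exists_heaviest_maximum_clique (w : T -> nat) :
  exists K, heaviest_maximum_clique e w K.
Proof.
pose cliqueb K := [forall x in K, forall y in K, (x != y) ==> e x y].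
have cliqueP K : reflect (clique e K) (cliqueb K).
  apply: (iffP 'forall_in_'forall_in_implyP) => K_clique x.
    by move=> y xK yK; apply: K_clique.
  by move=> xK y yK; apply: K_clique.
have clique0 : cliqueb set0 by apply/cliqueP=> x y; rewrite inE.
have [M /cliqueP M_clique M_max] := arg_maxnP (fun K => #|K|) clique0.
pose maximum K := cliqueb K && (#|M| <= #|K|).
have maximumM : maximum M by rewrite /maximum leqnn andbT; apply/cliqueP.
have [K /andP[/cliqueP K_clique leMK] K_heavy] :=
  arg_maxnP (fun K => \sum_(x in K) w x) maximumM.
exists K; split=> [|L [/cliqueP L_clique L_max]]; last first.
  by apply: K_heavy; rewrite /maximum L_clique L_max.
by split=> // L /cliqueP/M_max leLM; apply: leq_trans leMK.
Qed.

Hypothesis e_sym : symmetric e.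

Lemma clique_setU1 x K :
  clique e K -> {in K, forall y, e x y} -> clique e (x |: K).
Proof.
move=> K_clique xK p q /setU1P[->|pK] /setU1P[->|qK] neq_pq.
- by rewrite eqxx in neq_pq.
- exact: xK.
- by rewrite e_sym xK.
- exact: K_clique.
Qed.

Lemma maximum_clique_missed K x :
  maximum_clique e K -> x \notin K -> exists2 u, u \in K & ~~ e x u.
Proof.
move=> [K_clique K_max] xK; apply/exists_inP; apply: contraT.
rewrite negb_exists_in => /forall_inP adj.
have /K_max : clique e (x |: K).
  by apply: clique_setU1 => // u /adj; rewrite negbK.
by rewrite cardsU1 xK ltnn.
Qed.

Lemma maximum_clique_exchange K u x :
  maximum_clique e K -> u \in K -> x \notin K -> {in K :\ u, forall v, e x v} ->
  maximum_clique e (x |: K :\ u).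
Proof.
move=> [K_clique K_max] uK xK x_adj; split.
  apply: clique_setU1 => // p q /setD1P[_ pK] /setD1P[_ qK]; exact: K_clique.
have xKu : x \notin K :\ u by rewrite !inE (negPf xK) andbF.
by move=> L /K_max; rewrite cardsU1 xKu (cardsD1 u K) uK.
Qed.

Lemma heaviest_maximum_clique_exchange (w : T -> nat) K u x :
  heaviest_maximum_clique e w K -> u \in K -> x \notin K ->
  {in K :\ u, forall v, e x v} -> w x <= w u.
Proof.
move=> [K_max K_heavy] uK xK x_adj.
have xKu : x \notin K :\ u by rewrite !inE (negPf xK) andbF.
have := K_heavy _ (maximum_clique_exchange K_max uK xK x_adj).
by rewrite big_setU1 //= [X in _ <= X](big_setD1 u uK) leq_add2r.
Qed.

End MaximumCliques.

Section ForbiddenSubgraphs.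

Variables (T : finType) (e : rel T).
Implicit Types K : {set T}.
Hypotheses (e_sym : symmetric e) (e_irr : irreflexive e).
Hypotheses (no_2K2 : twoK2_free e) (no_C4 : C4_free e) (no_C5 : C5_free e).

Lemma induced_P4_neighbours_proper y x w u :
  e y x -> e x w -> e w u -> ~~ e y w -> ~~ e y u -> ~~ e x u ->
  neighbours e u \proper neighbours e x.
Proof.
move=> yx xw wu yw yu xu; rewrite properE andbC; apply/andP; split.
  by apply/subsetPn; exists y; rewrite inE // e_sym.
apply/subsetP=> z; rewrite !inE => uz; apply: contraT => xz.
have zy : e z y.
  have := no_2K2 yx uz.
  by rewrite (negPf yu) (negPf xu) (negPf xz) !orbF [e z y]e_sym.
have uw : e u w by rewrite e_sym.
have [zw | zw] := boolP (e z w).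
  have neq_zx : z != x by apply: contraTneq uz => ->; rewrite e_sym.
  have neq_yw : y != w by apply: contraTneq wu => <-.
  have := no_C4 neq_zx neq_yw zy yx xw zw.
  by rewrite e_sym (negPf xz) (negPf yw).
have := no_C5 uz zy yx xw uw.
rewrite (e_sym u y) (e_sym u x) (e_sym z x).
by rewrite (negPf yu) (negPf xu) (negPf xz) (negPf zw) (negPf yw).
Qed.

Lemma clique_missed_by_edge_unique K x y u v :
  clique e K -> e x y -> u \in K -> v \in K ->
  ~~ e x u -> ~~ e y u -> ~~ e x v -> ~~ e y v -> u = v.
Proof.
move=> K_clique exy uK vK xu yu xv yv; apply: contraTeq exy => neq_uv.
apply/negP=> /no_2K2/(_ (K_clique _ _ uK vK neq_uv)).
by rewrite (negPf xu) (negPf xv) (negPf yu) (negPf yv).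
Qed.

Lemma edge_neighbours_nested K x y :
  clique e K -> x \notin K -> y \notin K -> e x y ->
  {in K, forall u, e x u -> e y u} \/ {in K, forall u, e y u -> e x u}.
Proof.
move=> K_clique xK yK exy.
have [/forall_inP sub | ] := boolP [forall u in K, e x u ==> e y u].
  by left=> u /sub/implyP.
rewrite negb_forall_in => /exists_inP[w wK]; rewrite negb_imply => /andP[xw yw].
right=> u uK yu; apply: contraT => xu.
have neq_xu : x != u by apply: contraNneq xK => ->.
have neq_wy : w != y by apply: contraNneq yK => <-.
have neq_wu : w != u by apply: contraTneq xw => ->.
have uy : e u y by rewrite e_sym.
have := no_C4 neq_xu neq_wy xw (K_clique _ _ wK uK neq_wu) uy exy.
by rewrite (negPf xu) e_sym (negPf yw).
Qed.

Lemma split_graph_of_2K2_C4_C5_free : split_graph e.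
Proof.
have [K K_heaviest] :=
  exists_heaviest_maximum_clique e (fun x => #|neighbours e x|).
have K_max := K_heaviest.1; have K_clique := K_max.1.
apply/split_graphP; exists K => // x y; rewrite !inE.
wlog sub : x y / {in K, forall u, e y u -> e x u}.
  move=> wlog_sub xK yK; apply/negP=> exy.
  have [sub|sub] := edge_neighbours_nested K_clique xK yK exy.
    by have := wlog_sub y x sub yK xK; rewrite e_sym exy.
  by have := wlog_sub x y sub xK yK; rewrite exy.
move=> xK yK; apply/negP=> exy.
have [u uK xu] := maximum_clique_missed e_sym K_max xK.
have yu : ~~ e y u by apply: contra xu; apply: sub.
have x_adj : {in K :\ u, forall v, e x v}.
  move=> v /setD1P[neq_vu vK]; apply: contraNT neq_vu => xv.
  have yv : ~~ e y v by apply: contra xv; apply: sub.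
  by rewrite (clique_missed_by_edge_unique K_clique exy vK uK).
have yL : y \notin x |: K :\ u.
  by rewrite !inE negb_or (negPf yK) andbF andbT eq_sym (adjacent_neq e_irr).
have L_max := maximum_clique_exchange e_sym K_max uK xK x_adj.
have [w wL yw] := maximum_clique_missed e_sym L_max yL.
have wKu : w \in K :\ u.
  by case/setU1P: wL yw => // ->; rewrite e_sym exy.
have [neq_wu wK] := setD1P wKu.
have := heaviest_maximum_clique_exchange e_sym K_heaviest uK xK x_adj.
rewrite leqNgt proper_card // (@induced_P4_neighbours_proper y x w u) //.
- by rewrite e_sym.
- exact: x_adj.
- exact: K_clique.
Qed.

End ForbiddenSubgraphs.

Lemma chordal_cochordal_split (T : finType) (e : rel T) :
  symmetric e -> irreflexive e -> chordal e ->
  chordal (compl_graph e) -> split_graph e.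
Proof.
move=> e_sym e_irr e_chordal compl_chordal.
apply: split_graph_of_2K2_C4_C5_free => //.
- apply: compl_C4_free_twoK2_free => //; apply: chordal_C4_free => //.
    exact: compl_graph_sym.
  exact: compl_graph_irr.
- exact: chordal_C4_free.
- exact: chordal_C5_free.
Qed.

Theorem theorem10 (T : finType) (e : rel T)
    (e_sym : symmetric e) (e_irr : irreflexive e) :
  [<-> split_graph e;
       chordal e /\ chordal (compl_graph e);
       exists v : 'I_#|T| -> T,
         [/\ vertex_ordering v,
             forall i j k : 'I_#|T|, i < j -> j < k ->
               e (v i) (v j) -> e (v i) (v k) -> e (v j) (v k)
           & forall i j k : 'I_#|T|, i < j -> j < k ->
               e (v i) (v j) -> e (v j) (v k) \/ e (v i) (v k)];
       exists v : 'I_#|T| -> T,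
         vertex_ordering v /\
         forall i j k : 'I_#|T|, i < j -> j < k ->
           e (v i) (v j) -> e (v j) (v k)].
Proof.
tfae.
- move=> split_e; split; first exact: split_graph_chordal.
  exact/split_graph_chordal/split_graph_compl.
- move=> [e_chordal compl_chordal].
  have split_e := chordal_cochordal_split e_sym e_irr e_chordal compl_chordal.
  have [v v_bij v_split] := split_graph_ordering split_e.
  exists v; split=> // i j k ltij ltjk eij.
    by move=> _; apply: v_split eij.
  by left; apply: v_split eij.
- move=> [v [v_bij v_chordal v_cochordal]]; exists v; split=> //.
  move=> i j k ltij ltjk eij.
  by have [// | eik] := v_cochordal i j k ltij ltjk eij; apply: v_chordal eik.
- by move=> [v [v_bij v_split]]; apply: split_ordering_split_graph v_split.
Qed.
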